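(* Let $R$ be a discrete $\Gamma$-ring and $r\in R[2]$ a formal difference law in $R$. Then there is a unique multiplicative map (morphism of $\Gamma$-rings) $\phi:H\mathbb{Z}\to R$ with $\phi(\pm1_n)=r^n\in R[2^n]$ for all $n\ge0$; explicitly $\phi(n_1,\dots,n_k)=f(r^n)$ for any $n$ and any pointed map $f:[2^n]\to[k]$ with $f(\pm1_n)=(n_1,\dots,n_k)$.
   Context: Let $[n]=\{0,1,\dots,n\}$, pointed at $0$. A $\Gamma$-space is a functor $F$ from the finite pointed sets $[n]$ (with pointed maps) to pointed simplicial sets with $F[0]$ a point; for a pointed map $f$ we write $f$ also for $F(f)$; $\Sigma_n$ acts on $F[n]$ via permutations of $\{1,\dots,n\}$. We identify $[n]\wedge[m]$ with $[nm]$ via $i\wedge j\mapsto (j-1)n+i$. A $\Gamma$-ring is a $\Gamma$-space $R$ with unit $1\in R[1]$ (image of the unit map $\eta$) and associative unital multiplication given by natural maps $R(K)\wedge R(L)\to R(K\wedge L)$, $p\wedge q\mapsto pq$; it is discrete if all $R(K)$ are sets; $0\in R[1]$ denotes the basepoint. For $x\in R[2]$, $x^k\in R[2^k]$ is the $k$-fold product, $x^0=1$. A multiplicative map of $\Gamma$-rings is a natural transformation preserving units and products. Maps: $p^n_i:[n]\to[n-1]$, $p^n_i(j)=j$ ($j<i$), $p^n_i(i)=0$, $p^n_i(j)=j-1$ ($j>i$); for $1\le i<j\le n$ and $1\le k\le n-1$, $s^n_{i,j,k}:[n]\to[n-1]$ sends $0\mapsto0$, $i,j\mapsto k$, and the remaining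 elements order-preservingly and bijectively onto $\{1,\dots,n-1\}\setminus\{k\}$; $d^n_j:[n-1]\to[n]$ is the order-preserving injection missing $j$. $H\mathbb{Z}$ is the $\Gamma$-ring with $H\mathbb{Z}(K)$ the reduced free abelian group on $K$ (so $H\mathbb Z[k]=\mathbb Z^k$), pointed maps acting by summing coefficients along fibres, unit the inclusion of generators, multiplication $(\sum a_k k)(\sum b_l l)=\sum a_kb_l (k\wedge l)$. $\pm1_n=(1,-1)^n\in H\mathbb{Z}[2^n]$ (the $n$-th power of $(1,-1)\in H\mathbb Z[2]$). For $k\ge1$, split $\{1,\dots,2^k\}=A_+\sqcup A_-$ where $i\in A_+$ iff the binary expansion of $i-1$ has an even number of digits $1$. The special action of $\Sigma_{2^{k-1}}\times\Sigma_{2^{k-1}}$ on $F[2^k]$ is the action of the group of permutations of $\{1,\dots,2^k\}$ preserving $A_+$ and $A_-$. Let $\sigma$ be the nontrivial element of $\Sigma_2$. A formal difference law in $R$ is $r\in R[2]$ such that: (1) $p^2_2(r)=1$ and $s^2_{1,2,1}(r)=0$; (2) $p^2_1(r)\,r=r\,p^2_1(r)=\sigma(r)$ in $R[2]$; (3) for every $k\ge1$, $r^k$ is fixed under the special action; (4) for every $k\ge1$, all $1\le i<j\le 2^k$ with one of $i,j$ in $A_+$ and the other in $A_-$, and all $1\le l\le 2^k-1$: $s^{2^k}_{i,j,l}(r^k)=d^{2^k-1}_l\,p^{2^k-1}_i\,p^{2^k}_j(r^k)$. *)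

(* Defs.v *)
From HB Require Import structures.
From mathcomp Require Import all_boot all_order all_algebra all_fingroup.
Set Implicit Arguments. Unset Strict Implicit. Unset Printing Implicit Defensive.
Import GRing.Theory.

(* [n] is represented by 'I_n.+1, basepoint ord0. *)
Definition ptmap (n m : nat) := {f : {ffun 'I_n.+1 -> 'I_m.+1} | f ord0 == ord0}.

Definition pmv n m (f : ptmap n m) (l : nat) : nat := sval f (inord l).

(* build a pointed map from a nat function (0 is sent to 0; values are
   read through inord, only used with in-range values) *)
Definition mkpt_fun n m (g : nat -> nat) : {ffun 'I_n.+1 -> 'I_m.+1} :=
  [ffun i : 'I_n.+1 => if nat_of_ord i == 0%N then ord0 else inord (g i)].
Lemma mkpt_ok n m (g : nat -> nat) : mkpt_fun n m g ord0 == ord0.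
Proof. by rewrite /mkpt_fun ffunE eqxx. Qed.
Definition mkpt n m (g : nat -> nat) : ptmap n m := exist (fun f : {ffun 'I_n.+1 -> 'I_m.+1} => f ord0 == ord0) _ (mkpt_ok n m g).

Definition ptid n : ptmap n n := mkpt n n id.
Definition ptcomp n m k (g : ptmap m k) (f : ptmap n m) : ptmap n k :=
  mkpt n k (fun l => pmv g (pmv f l)).

(* smash of pointed maps, using [n]^[m] = [nm], i /\ j |-> (j-1)n+i *)
Definition ptsmash n n' m m' (f : ptmap n n') (g : ptmap m m')
  : ptmap (n * m) (n' * m') :=
  mkpt (n * m) (n' * m') (fun k =>
    let i := (k.-1 %% n).+1 in
    let j := (k.-1 %/ n).+1 in
    let fi := pmv f i in
    let gj := pmv g j in
    if (fi == 0%N) || (gj == 0%N) then 0%N else (gj.-1 * n' + fi)%N).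

Definition tcast (F : nat -> Type) (a b : nat) (e : a = b) (x : F a) : F b :=
  eq_rect a F x b e.

Record GRData := {
  car : nat -> Type;
  gr_pt : forall n, car n;
  gr_act : forall n m, ptmap n m -> car n -> car m;
  gr_one : car 1;
  gr_mul : forall n m, car n -> car m -> car (n * m)
}.
Arguments gr_pt {_} n.
Arguments gr_act {_ n m} f x.
Arguments gr_one {_}.
Arguments gr_mul {_ n m} x y.

Definition is_GammaRing (R : GRData) : Prop :=
  (forall n (x : car R n), gr_act (ptid n) x = x) /\
  (forall n m k (f : ptmap n m) (g : ptmap m k) (x : car R n),
      gr_act (ptcomp g f) x = gr_act g (gr_act f x)) /\
  (forall n m (f : ptmap n m), gr_act f (gr_pt n : car R n) = gr_pt m) /\
  (forall x : car R 0, x = gr_pt 0) /\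
  (* multiplication is defined on the smash product *)
  (forall n m (q : car R m), gr_mul (gr_pt n : car R n) q = gr_pt (n * m)) /\
  (forall n m (p : car R n), gr_mul p (gr_pt m : car R m) = gr_pt (n * m)) /\
  (forall n n' m m' (f : ptmap n n') (g : ptmap m m') (p : car R n) (q : car R m),
      gr_mul (gr_act f p) (gr_act g q) = gr_act (ptsmash f g) (gr_mul p q)) /\
  (forall n (p : car R n), @tcast (car R) _ _ (mul1n n) (gr_mul gr_one p) = p) /\
  (forall n (p : car R n), @tcast (car R) _ _ (muln1 n) (gr_mul p gr_one) = p) /\
  (forall n m k (p : car R n) (q : car R m) (s : car R k),
      @tcast (car R) _ _ (esym (mulnA n m k)) (gr_mul (gr_mul p q) s) = gr_mul p (gr_mul q s)).

Fixpoint pw (R : GRData) (x : car R 2) (k : nat) : car R (2 ^ k) :=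
  match k return car R (2 ^ k) with
  | 0 => gr_one
  | k'.+1 => @tcast (car R) _ _ (esym (expnSr 2 k')) (gr_mul (pw x k') x)
  end.

Definition is_mult (D E : GRData) (phi : forall n, car D n -> car E n) : Prop :=
  [/\ (forall n m (f : ptmap n m) (x : car D n), phi m (gr_act f x) = gr_act f (phi n x)),
      (forall n, phi n (gr_pt n) = gr_pt n),
      phi 1%N gr_one = gr_one &
      (forall n m (x : car D n) (y : car D m), phi (n * m)%N (gr_mul x y) = gr_mul (phi n x) (phi m y))].

(* HZ[n] = Z^n; coordinate i : 'I_n is the coefficient of the generator i+1 *)
Definition hz_act n m (f : ptmap n m) (a : n.-tuple int) : m.-tuple int :=
  [tuple (\sum_(i < n | nat_of_ord (sval f (lift ord0 i)) == j.+1) tnth a i)%R | j < m].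
Definition hz_mul n m (a : n.-tuple int) (b : m.-tuple int) : (n * m).-tuple int :=
  [tuple (nth 0 a (k %% n) * nth 0 b (k %/ n))%R | k < n * m].
Definition hz_pt n : n.-tuple int := [tuple 0%R | i < n].
Definition hz_one : 1.-tuple int := [tuple 1%R].

Definition HZ : GRData :=
  {| car := fun n => n.-tuple int; gr_pt := hz_pt; gr_act := hz_act;
     gr_one := hz_one; gr_mul := hz_mul |}.

Definition hz_pm : car HZ 2 := [tuple 1%R; (-1)%R].
Definition pm1 (n : nat) : car HZ (2 ^ n) := pw hz_pm n.

Definition pmap n i : ptmap n n.-1 :=
  mkpt n n.-1 (fun l => if l < i then l else if l == i then 0 else l.-1).
Definition smap n i j k : ptmap n n.-1 :=
  mkpt n n.-1 (fun l =>
    if l == 0 then 0 else if (l == i) || (l == j) then k else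
    let rk := (l - (i < l) - (j < l))%N in if rk < k then rk else rk.+1).
Definition dmap n j : ptmap n.-1 n :=
  mkpt n.-1 n (fun l => if l < j then l else l.+1).
Definition swap2 : ptmap 2 2 :=
  mkpt 2 2 (fun l => if l == 1 then 2 else if l == 2 then 1 else l).
Definition ptperm N (s : {perm 'I_N.+1}) : ptmap N N :=
  mkpt N N (fun l => nat_of_ord (s (inord l))).

Definition ones (x : nat) : nat := \sum_(b < x.+1) (odd (x %/ 2 ^ b) : nat).
(* element e >= 1 of {1..2^k} lies in A_+ iff inAp (e-1) *)
Definition inAp (x : nat) : bool := ~~ odd (ones x).

Definition fdl (R : GRData) (r : car R 2) : Prop :=
  [/\
      gr_act (pmap 2 2) r = gr_one /\ gr_act (smap 2 1 2 1) r = gr_pt 1,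
      @tcast (car R) _ _ (mul1n 2) (gr_mul (gr_act (pmap 2 1) r) r) = gr_act swap2 r /\
      @tcast (car R) _ _ (muln1 2) (gr_mul r (gr_act (pmap 2 1) r)) = gr_act swap2 r,
      (forall k, 0 < k -> forall s : {perm 'I_(2 ^ k).+1},
          s ord0 = ord0 ->
          (forall x : 'I_(2 ^ k).+1, x != ord0 -> inAp (s x).-1 = inAp x.-1) ->
          gr_act (ptperm s) (pw r k) = pw r k) &
      (forall k, 0 < k -> forall i j l,
          1 <= i -> i < j -> j <= 2 ^ k -> inAp i.-1 != inAp j.-1 ->
          1 <= l -> l <= (2 ^ k).-1 ->
          gr_act (smap (2 ^ k) i j l) (pw r k)
          = gr_act (dmap (2 ^ k).-1 l) (gr_act (pmap (2 ^ k).-1 i) (gr_act (pmap (2 ^ k) j) (pw r k))))].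

(* Main.v *)
(** Call two elements of [[2^n]] a cancelling pair for [f : [2^n] -> [k]] if they
    have opposite signs and the same image.  By condition (4) such a pair can be
    sent to the base point without changing [f(r^n)], and this does not change
    [f(±1_n)] either.  When no pair is left ([f] is reduced), each fibre of [f]
    over a non-base point has constant sign, so its size is the absolute value
    of a coefficient of [f(±1_n)]; hence [f] is determined up to a
    sign-preserving permutation, which is absorbed by condition (3).  So
    [f(r^n)] depends only on [f(±1_n)].  Since [p^2_2(r) = 1], one and the same
    truncation [[2^m] -> [2^n]] carries [r^m] to [r^n] and [±1_m] to [±1_n], so
    the value does not depend on [n] either.  Finally every tuple is some
    [f(±1_n)], because the two halves of [±1_(n+1)] are [±1_n] and its negative,
    which makes the set of such tuples closed under subtraction. *)
Require Import Defs.
From HB Require Import structures.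
From mathcomp Require Import all_boot all_order all_algebra all_fingroup.
From mathcomp Require Import zify.
Set Implicit Arguments. Unset Strict Implicit. Unset Printing Implicit Defensive.
Import GRing.Theory.

Lemma big_ord_mul (T : Type) (idx : T) (op : Monoid.law idx) n m (F : nat -> nat -> T) :
  \big[op/idx]_(t < n * m) F (t %% n) (t %/ n) =
  \big[op/idx]_(j < m) \big[op/idx]_(i < n) F i j.
Proof.
elim: m => [|m IHm]; first by rewrite muln0 !big_ord0.
rewrite big_ord_recr /= -IHm mulnSr big_split_ord /=; congr (op _ _).
apply: eq_bigr => i _; have n_gt0 := leq_ltn_trans (leq0n _) (ltn_ord i).
by rewrite mulnC modnMDl modn_small // divnMDl // divn_small // addn0.
Qed.

Lemma eq_card_fibers_perm (T : finType) (S : eqType) (f g : T -> S) :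
    (forall y, #|[pred t | f t == y]| = #|[pred t | g t == y]|) ->
  exists p : {perm T}, forall t, f t = g (p t).
Proof.
move=> fg; have /tuple_permP[p fgp] : perm_eq (codom f) (codom_tuple g).
  apply/allP => y _; apply/eqP; rewrite /= /codom /image_mem !count_map.
  by have := fg y; rewrite !cardE /enum_mem !size_filter -!enumT.
have tnth_codom (h : T -> S) i : tnth (codom_tuple h) i = h (enum_val i).
  have x := enum_val i; rewrite (tnth_nth (h x)) (nth_map x) ?(enum_val_nth x) //.
  by rewrite -cardE.
have conj_inj : injective (fun t => enum_val (p (enum_rank t))).
  by move=> t u /enum_val_inj/perm_inj/enum_rank_inj.
have fg_tuple : codom_tuple f = [tuple tnth (codom_tuple g) (p i) | i < #|T|].
  exact: val_inj.
exists (perm conj_inj) => t; rewrite permE -[t in LHS]enum_rankK -!tnth_codom.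
by rewrite fg_tuple tnth_mktuple.
Qed.

Lemma tuple_nth_eq (T : Type) (x0 : T) n (a b : n.-tuple T) :
  (forall i, i < n -> nth x0 a i = nth x0 b i) -> a = b.
Proof. by move=> ab; apply: eq_from_tnth => i; rewrite !(tnth_nth x0) ab. Qed.

Lemma nth_tcast (T : Type) (x0 : T) a b (e : a = b) (x : a.-tuple T) i :
  nth x0 (Defs.tcast (F := fun n => n.-tuple T) e x) i = nth x0 x i.
Proof. by case: b / e. Qed.

Lemma pmv0 n m (f : ptmap n m) : pmv f 0 = 0.
Proof.
case: f => f f0; rewrite /pmv /=.
have -> : inord 0 = ord0 :> 'I_n.+1 by apply: val_inj; rewrite /= inordK.
by rewrite (eqP f0).
Qed.

Lemma pmv_le n m (f : ptmap n m) l : pmv f l <= m.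
Proof. by rewrite -ltnS ltn_ord. Qed.

Lemma pmv_lift n m (f : ptmap n m) (i : 'I_n) : pmv f i.+1 = sval f (lift ord0 i).
Proof.
rewrite /pmv; congr (nat_of_ord (sval f _)).
by apply: val_inj; rewrite /= inordK // ltnS.
Qed.

Lemma pmv_mkpt n m g l : 0 < l <= n -> g l <= m -> pmv (mkpt n m g) l = g l.
Proof.
case/andP=> l_gt0 le_ln le_gm; rewrite /pmv /= ffunE inordK ?ltnS //.
by rewrite eqn0Ngt l_gt0 /= inordK ?ltnS.
Qed.

Lemma ptmap_eq n m (f g : ptmap n m) :
  (forall l, 0 < l <= n -> pmv f l = pmv g l) -> f = g.
Proof.
move=> fg; apply: val_inj; apply/ffunP => i; apply: val_inj => /=.
rewrite -[i]inord_val -!/(pmv _ _).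
have [->|i_gt0] := posnP i; first by rewrite /= !pmv0.
by apply: fg; rewrite i_gt0 -ltnS /=.
Qed.

Lemma pmv_id n l : l <= n -> pmv (ptid n) l = l.
Proof. by case: l => [|l] le_ln; rewrite ?pmv0 ?pmv_mkpt. Qed.

Lemma pmv_comp n m k (g : ptmap m k) (f : ptmap n m) l :
  l <= n -> pmv (ptcomp g f) l = pmv g (pmv f l).
Proof. by case: l => [|l] le_ln; rewrite ?pmv0 ?pmv_mkpt ?pmv_le. Qed.

Lemma pmv_smash n n' m m' (f : ptmap n n') (g : ptmap m m') t :
  t < n * m ->
  let u := pmv f (t %% n).+1 in let v := pmv g (t %/ n).+1 in
  pmv (ptsmash f g) t.+1 = if (u == 0) || (v == 0) then 0 else v.-1 * n' + u.
Proof.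
move=> lt_tnm u v; rewrite /ptsmash pmv_mkpt //= -/u -/v.
case: ifP => // /norP[_ v_neq0].
have [le_un le_vm] : u <= n' /\ v <= m' by rewrite !pmv_le.
by case: v le_vm v_neq0 => //; nia.
Qed.

Lemma pmv_smash_eq n n' m m' (f : ptmap n n') (g : ptmap m m') t k :
  t < n * m ->
  (pmv (ptsmash f g) t.+1 == k.+1) =
  (pmv f (t %% n).+1 == (k %% n').+1) && (pmv g (t %/ n).+1 == (k %/ n').+1).
Proof.
move=> lt_tnm; rewrite (pmv_smash f g lt_tnm).
have := pmv_le f (t %% n).+1.
case: (pmv f _) => [|u] //= lt_un; case: (pmv g _) => [|v] /=; first by rewrite andbF.
rewrite !eqSS addnS eqSS; apply/eqP/andP => [<-|[/eqP -> /eqP ->]]; last first.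
  by rewrite -divn_eq.
have n'_gt0 := leq_ltn_trans (leq0n u) lt_un.
by rewrite modnMDl modn_small // divnMDl // divn_small // addn0 !eqxx.
Qed.

(* A cast when [n = m], an inclusion when [n <= m], a truncation otherwise. *)
Definition ptpid n m : ptmap n m := mkpt n m (fun l => if l <= m then l else 0).

Lemma pmv_pid n m l : l <= n -> pmv (ptpid n m) l = if l <= m then l else 0.
Proof. by case: l => [|l] le_ln; rewrite ?pmv0 ?pmv_mkpt //; case: ifP. Qed.

Lemma ptpid_id n : ptpid n n = ptid n.
Proof. by apply: ptmap_eq => l /andP[_ le_ln]; rewrite pmv_pid // le_ln pmv_id. Qed.

Lemma ptcomp_pid n m k : k <= m -> ptcomp (ptpid m k) (ptpid n m) = ptpid n k.
Proof.
move=> le_km; apply: ptmap_eq => l /andP[_ le_ln]; rewrite pmv_comp // !pmv_pid //.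
  by do !case: ifP => //; lia.
by case: ifP.
Qed.

Definition ptcopair n m k (f : ptmap n k) (g : ptmap m k) : ptmap (n + m) k :=
  mkpt (n + m) k (fun l => if l <= n then pmv f l else pmv g (l - n)).

Lemma pmv_copair_lshift n m k (f : ptmap n k) (g : ptmap m k) (i : 'I_n) :
  pmv (ptcopair f g) (lshift m i).+1 = pmv f i.+1.
Proof. by rewrite pmv_mkpt /= ?ltn_ord ?pmv_le // ltn_addr. Qed.

Lemma pmv_copair_rshift n m k (f : ptmap n k) (g : ptmap m k) (i : 'I_m) :
  pmv (ptcopair f g) (rshift n i).+1 = pmv g i.+1.
Proof.
have not_left : (n + i < n) = false by rewrite ltnNge leq_addr.
by rewrite pmv_mkpt /= ?not_left -?addnS ?leq_add2l ?addKn ?pmv_le.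
Qed.

Definition erase n k (f : ptmap n k) (i j : nat) : ptmap n k :=
  mkpt n k (fun l => if (l == i) || (l == j) then 0 else pmv f l).

Lemma pmv_erase n k (f : ptmap n k) i j l : 0 < l <= n ->
  pmv (erase f i j) l = if (l == i) || (l == j) then 0 else pmv f l.
Proof. by move=> ?; rewrite pmv_mkpt //; case: ifP => // _; apply: pmv_le. Qed.

Lemma eraseC n k (f : ptmap n k) i j : erase f i j = erase f j i.
Proof. by apply: ptmap_eq => l l_n; rewrite !pmv_erase // orbC. Qed.

Lemma pmv_dmap n j l : 0 < l < n -> pmv (dmap n j) l = if l < j then l else l.+1.
Proof. by move=> l_n; rewrite pmv_mkpt //; do ?case: ifP; lia. Qed.

Lemma pmv_pmap n i l : i <= n -> 0 < l <= n ->
  pmv (Defs.pmap n i) l = if l == i then 0 else l - (i < l).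
Proof. by move=> le_in l_n; rewrite pmv_mkpt //; do ?case: ifP; lia. Qed.

Lemma pmv_smap n i j l : 0 < i < j -> j <= n -> 0 < l <= n ->
  pmv (smap n i j i) l = if l == j then i else l - (j < l).
Proof. by move=> lt_ij le_jn l_n; rewrite pmv_mkpt //=; do ?case: ifP; lia. Qed.

Lemma ptpid_double n : ptpid (n * 2) n =
  ptcomp (ptpid (n * 1) n) (ptsmash (ptid n) (Defs.pmap 2 2)).
Proof.
apply: ptmap_eq => -[|l] //= lt_l; rewrite pmv_comp // !pmv_pid ?pmv_le // pmv_smash //.
have n_gt0 : 0 < n by case: (n) lt_l.
rewrite pmv_id ?ltn_mod //.
have [lt_ln|le_nl] := ltnP l n.
  by rewrite divn_small // modn_small // pmv_pmap //= ?muln1 ?lt_ln.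
have -> : l %/ n = 1.
  by rewrite -(subnKC le_nl) divnDl // divnn n_gt0 divn_small //; lia.
by rewrite pmv_pmap.
Qed.

(* In condition (4) it is enough to take [l = i]: then [d_j] after [s_{i,j,i}]
   only moves [j] to [i], so every [f] with [f i = f j] factors through it. *)
Section CancelledPair.
Variables (n k : nat) (f : ptmap n k) (i j : nat).
Hypotheses (lt_0ij : 0 < i < j) (le_jn : j <= n).

Lemma ptcomp_dmap_smap :
  pmv f i = pmv f j -> ptcomp f (ptcomp (dmap n j) (smap n i j i)) = f.
Proof.
move=> fij; apply: ptmap_eq => l l_n; have /andP[_ le_ln] := l_n.
rewrite !pmv_comp // pmv_smap // pmv_dmap; last by case: ifP; lia.
have [->|l_neq_j] := eqVneq l j; first by case/andP: lt_0ij => _ ->.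
by congr (pmv f _); case: ifP; lia.
Qed.

Lemma ptcomp_dmap_pmap :
  ptcomp f (ptcomp (dmap n j)
    (ptcomp (dmap n.-1 i) (ptcomp (Defs.pmap n.-1 i) (Defs.pmap n j)))) =
  erase f i j.
Proof.
apply: ptmap_eq => l l_n; have /andP[_ le_ln] := l_n.
rewrite pmv_erase // !pmv_comp ?pmv_le // (pmv_pmap le_jn l_n).
have [->|l_neq_j] := eqVneq l j; first by rewrite orbT /= !pmv0.
have -> : pmv (Defs.pmap n.-1 i) (l - (j < l)) =
    if l == i then 0 else l - (j < l) - (i < l).
  by rewrite pmv_pmap; [do ?case: ifP; lia | lia | lia].
rewrite orbF; have [_|l_neq_i] := eqVneq l i; first by rewrite /= !pmv0.
rewrite [pmv (dmap n.-1 i) _]pmv_dmap; last by lia.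
by rewrite pmv_dmap; [congr (pmv f _)|]; do ?case: ifP; lia.
Qed.

End CancelledPair.

Section GammaRingTheory.
Variables (R : GRData) (R_ring : is_GammaRing R).

Lemma gr_act_id n (p : car R n) : gr_act (ptid n) p = p.
Proof. by case: R_ring => + _; apply. Qed.

Lemma gr_act_comp n m k (f : ptmap n m) (g : ptmap m k) (p : car R n) :
  gr_act (ptcomp g f) p = gr_act g (gr_act f p).
Proof. by case: R_ring => _ [+ _]; apply. Qed.

Lemma gr_act_pt n m (f : ptmap n m) : gr_act f (gr_pt n : car R n) = gr_pt m.
Proof. by case: R_ring => _ [_ [+ _]]; apply. Qed.

Lemma gr_pt_unique (p : car R 0) : p = gr_pt 0.
Proof. by case: R_ring => _ [_ [_ [+ _]]]; apply. Qed.

Lemma gr_mul_act n n' m m' (f : ptmap n n') (g : ptmap m m')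
    (p : car R n) (q : car R m) :
  gr_mul (gr_act f p) (gr_act g q) = gr_act (ptsmash f g) (gr_mul p q).
Proof. by case: R_ring => _ [_ [_ [_ [_ [_ [+ _]]]]]]; apply. Qed.

Lemma gr_mulr1 n (p : car R n) : Defs.tcast (muln1 n) (gr_mul p gr_one) = p.
Proof. by case: R_ring => _ [_ [_ [_ [_ [_ [_ [_ [+ _]]]]]]]]; apply. Qed.

Lemma gr_mulA n m k (p : car R n) (q : car R m) (s : car R k) :
  Defs.tcast (esym (mulnA n m k)) (gr_mul (gr_mul p q) s) = gr_mul p (gr_mul q s).
Proof. by case: R_ring => _ [_ [_ [_ [_ [_ [_ [_ [_ ]]]]]]]]; apply. Qed.

Lemma tcast_act n m (e : n = m) (p : car R n) : Defs.tcast e p = gr_act (ptpid n m) p.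
Proof. by case: m / e; rewrite ptpid_id gr_act_id. Qed.

Lemma Tagged_tcast n m (e : n = m) (p : car R n) :
  Tagged (car R) (Defs.tcast e p) = Tagged (car R) p.
Proof. by case: m / e. Qed.

(* Forgetting the index turns multiplication into an operation on the total
   space, where associativity and the recursion for powers carry no casts. *)
Let tmul (p q : {n & car R n}) := Tagged (car R) (gr_mul (tagged p) (tagged q)).

Lemma pwD (x : car R 2) n m :
  gr_mul (pw x n) (pw x m) =
  gr_act (ptpid (2 ^ (n + m)) (2 ^ n * 2 ^ m)) (pw x (n + m)).
Proof.
rewrite -(tcast_act (expnD 2 n m)); apply: eq_from_Tagged; rewrite Tagged_tcast.
have pw_tmul k : Tagged (car R) (pw x k.+1) =
    tmul (Tagged (car R) (pw x k)) (Tagged (car R) x).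
  by rewrite /= Tagged_tcast.
rewrite -[LHS]/(tmul (Tagged (car R) (pw x n)) (Tagged (car R) (pw x m))).
elim: m => [|m IHm]; first by rewrite addn0 /tmul /= -(Tagged_tcast (muln1 _)) gr_mulr1.
rewrite addnS !pw_tmul -IHm /tmul /=.
by rewrite -[in RHS](Tagged_tcast (esym (mulnA _ _ _))) gr_mulA.
Qed.

Lemma pw_pid (x : car R 2) n m :
  gr_act (Defs.pmap 2 2) x = gr_one -> n <= m ->
  gr_act (ptpid (2 ^ m) (2 ^ n)) (pw x m) = pw x n.
Proof.
have pid_id l : gr_act (ptpid (2 ^ l) (2 ^ l)) (pw x l) = pw x l.
  by rewrite ptpid_id gr_act_id.
move=> x_pmap; elim: m => [|m IHm]; rewrite leq_eqVlt => /predU1P[->|le_nm] //.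
have truncate_succ : gr_act (ptpid (2 ^ m.+1) (2 ^ m)) (pw x m.+1) = pw x m.
  rewrite /= tcast_act -gr_act_comp ptcomp_pid ?leq_exp2l //.
  rewrite ptpid_double gr_act_comp -gr_mul_act x_pmap gr_act_id.
  by rewrite -(tcast_act (muln1 _)) gr_mulr1.
by rewrite -IHm // -truncate_succ -gr_act_comp ptcomp_pid // leq_exp2l.
Qed.

End GammaRingTheory.

Section IntegralGammaRing.
Local Open Scope ring_scope.

Lemma nth_hz_act n m (f : ptmap n m) (a : car HZ n) j : (j < m)%N ->
  nth 0 (gr_act f a) j = \sum_(i < n | pmv f i.+1 == j.+1) nth 0 a i.
Proof.
move=> lt_jm; rewrite (nth_mktuple _ 0 (Ordinal lt_jm)).
by apply: eq_big => i; rewrite ?pmv_lift // => _; rewrite (tnth_nth 0).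
Qed.

Lemma nth_hz_mul n m (a : car HZ n) (b : car HZ m) k : (k < n * m)%N ->
  nth 0 (gr_mul a b) k = nth 0 a (k %% n)%N * nth 0 b (k %/ n)%N.
Proof. by move=> lt_knm; apply: (nth_mktuple _ 0 (Ordinal lt_knm)). Qed.

Lemma nth_hz_pt n i : nth 0 (gr_pt n : car HZ n) i = 0.
Proof.
have [le_ni|lt_in] := leqP n i; first by rewrite nth_default // size_tuple.
exact: (nth_mktuple _ 0 (Ordinal lt_in)).
Qed.

Lemma hz_act_id n (a : car HZ n) : gr_act (ptid n) a = a.
Proof.
apply: (@tuple_nth_eq _ 0) => i lt_in.
by rewrite nth_hz_act // (big_pred1 (Ordinal lt_in)) // => j; rewrite pmv_id ?eqSS.
Qed.

Lemma hz_act_comp n m k (f : ptmap n m) (g : ptmap m k) (a : car HZ n) :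
  gr_act (ptcomp g f) a = gr_act g (gr_act f a).
Proof.
apply: (@tuple_nth_eq _ 0) => i lt_ik; rewrite !nth_hz_act //.
pose f_ord (j : 'I_n) : 'I_m.+1 := sval f (lift ord0 j).
rewrite (partition_big f_ord (fun l => pmv g l == i.+1)) => [|j]; last first.
  by rewrite pmv_comp // pmv_lift.
rewrite big_mkcond big_ord_recl /= pmv0 add0r -big_mkcond /=.
apply: eq_bigr => l /eqP gl; rewrite nth_hz_act //; apply: eq_bigl => j.
rewrite -val_eqE /= pmv_comp // pmv_lift -/(f_ord j).
by case: (nat_of_ord (f_ord j) =P l.+1) => [->|_]; rewrite ?gl ?eqxx ?andbF.
Qed.

Lemma hz_act_pt n m (f : ptmap n m) : gr_act f (gr_pt n : car HZ n) = gr_pt m.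
Proof.
apply: (@tuple_nth_eq _ 0) => i lt_im.
by rewrite nth_hz_act // nth_hz_pt big1 // => j _; rewrite nth_hz_pt.
Qed.

Lemma hz_mul_ptl n m (b : car HZ m) : gr_mul (gr_pt n : car HZ n) b = gr_pt (n * m).
Proof.
by apply: (@tuple_nth_eq _ 0) => i lt_inm; rewrite nth_hz_mul // !nth_hz_pt mul0r.
Qed.

Lemma hz_mul_ptr n m (a : car HZ n) : gr_mul a (gr_pt m : car HZ m) = gr_pt (n * m).
Proof.
by apply: (@tuple_nth_eq _ 0) => i lt_inm; rewrite nth_hz_mul // !nth_hz_pt mulr0.
Qed.

Lemma hz_mul_act n n' m m' (f : ptmap n n') (g : ptmap m m')
    (a : car HZ n) (b : car HZ m) :
  gr_mul (gr_act f a) (gr_act g b) = gr_act (ptsmash f g) (gr_mul a b).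
Proof.
apply: (@tuple_nth_eq _ 0) => k lt_k.
have n'_gt0 : (0 < n')%N by case: (n') lt_k.
rewrite nth_hz_mul // !nth_hz_act ?ltn_mod ?ltn_divLR // 1?mulnC //.
rewrite big_mkcond [X in _ * X]big_mkcond [RHS]big_mkcond /=.
pose term i j := if (pmv f i.+1 == (k %% n').+1) && (pmv g j.+1 == (k %/ n').+1)
  then nth 0 a i * nth 0 b j else 0.
rewrite [RHS](eq_bigr (fun t : 'I_(n * m) => term (t %% n)%N (t %/ n)%N)); last first.
  by move=> t _; rewrite pmv_smash_eq // nth_hz_mul.
rewrite big_ord_mul mulr_sumr; apply: eq_bigr => j _.
rewrite mulr_suml; apply: eq_bigr => i _; rewrite /term.
by do 2!case: ifP => _; rewrite ?mul0r ?mulr0.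
Qed.

Lemma hz_mul1r n (a : car HZ n) : Defs.tcast (mul1n n) (gr_mul gr_one a) = a.
Proof.
apply: (@tuple_nth_eq _ 0) => i lt_in.
by rewrite nth_tcast nth_hz_mul ?mul1n // modn1 divn1 mul1r.
Qed.

Lemma hz_mulr1 n (a : car HZ n) : Defs.tcast (muln1 n) (gr_mul a gr_one) = a.
Proof.
apply: (@tuple_nth_eq _ 0) => i lt_in.
by rewrite nth_tcast nth_hz_mul ?muln1 // modn_small // divn_small // mulr1.
Qed.

Lemma hz_mulA n m k (a : car HZ n) (b : car HZ m) (c : car HZ k) :
  Defs.tcast (esym (mulnA n m k)) (gr_mul (gr_mul a b) c) = gr_mul a (gr_mul b c).
Proof.
apply: (@tuple_nth_eq _ 0) => i lt_i.
have lt_i_nmk : (i < n * m * k)%N by rewrite -mulnA.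
have nm_gt0 : (0 < n * m)%N by case: (n * m)%N lt_i_nmk.
have n_gt0 : (0 < n)%N by case: (n) nm_gt0.
rewrite nth_tcast !nth_hz_mul ?ltn_mod ?ltn_divLR //; last by rewrite mulnC mulnA.
rewrite modn_dvdm ?dvdn_mulr // divnMA mulrA; congr (_ * _ * _).
by rewrite modn_divl [(m * n)%N]mulnC.
Qed.

Lemma hz_is_GammaRing : is_GammaRing HZ.
Proof.
have hz_pt_unique (a : car HZ 0) : a = gr_pt 0 by exact: (@tuple_nth_eq _ 0).
split; first exact: hz_act_id.
split; first exact: hz_act_comp.
split; first exact: hz_act_pt.
split; first exact: hz_pt_unique.
split; first exact: hz_mul_ptl.
split; first exact: hz_mul_ptr.
split; first exact: hz_mul_act.
split; first exact: hz_mul1r.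
by split; [exact: hz_mulr1 | exact: hz_mulA].
Qed.

Definition hz_row n (a : car HZ n) : 'rV[int]_n := \row_j nth 0 a j.

Lemma hz_row_inj n : injective (@hz_row n).
Proof.
move=> a b /rowP ab; apply: (@tuple_nth_eq _ 0) => i lt_in.
by have := ab (Ordinal lt_in); rewrite !mxE.
Qed.

Lemma hz_row_act_copair n m k (f : ptmap n k) (g : ptmap m k)
    (a : car HZ n) (b : car HZ m) :
  hz_row (gr_act (ptcopair f g) (cat_tuple a b : car HZ (n + m))) =
  hz_row (gr_act f a) + hz_row (gr_act g b).
Proof.
apply/rowP => j; rewrite !mxE !nth_hz_act // big_split_ord /=; congr (_ + _).
  apply: eq_big => i; first by rewrite -(pmv_copair_lshift f g).
  by move=> _; rewrite nth_cat size_tuple ltn_ord.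
apply: eq_big => i; first by rewrite -(pmv_copair_rshift f g).
by move=> _; rewrite nth_cat size_tuple ltnNge leq_addr addKn.
Qed.

Lemma hz_row_act_opp n k (f : ptmap n k) (a : car HZ n) :
  hz_row (gr_act f (map_tuple -%R a : car HZ n)) = - hz_row (gr_act f a).
Proof.
apply/rowP => j; rewrite !mxE !nth_hz_act // -sumrN; apply: eq_bigr => i _.
by rewrite (nth_map 0) ?size_tuple.
Qed.

Lemma hz_act_erase n k (f : ptmap n k) (a : car HZ n) (i j : 'I_n) :
    i != j -> nth 0 a i + nth 0 a j = 0 -> pmv f i.+1 = pmv f j.+1 ->
  gr_act (erase f i.+1 j.+1) a = gr_act f a.
Proof.
rewrite eq_sym => j_neq_i aij fij; apply: (@tuple_nth_eq _ 0) => l lt_lk.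
rewrite !nth_hz_act // big_mkcond [RHS]big_mkcond.
rewrite (bigD1 i) //= (bigD1 j) //= [RHS](bigD1 i) //= [X in _ = _ + X](bigD1 j) //=.
rewrite !addrA; congr (_ + _).
  by rewrite !pmv_erase ?ltn_ord // !eqxx orbT fij; case: ifP; rewrite ?aij ?addr0.
apply: eq_bigr => t /andP[t_neq_i t_neq_j].
by rewrite pmv_erase ?ltn_ord // !eqSS !val_eqE (negPf t_neq_i) (negPf t_neq_j).
Qed.

End IntegralGammaRing.

Section SignTuples.
Local Open Scope ring_scope.

(* Generators are numbered from 0: [c i] says whether [i.+1] has sign [+1]. *)
Definition sign_tuple (c : pred nat) n : car HZ n :=
  [tuple if c i then 1 else -1 | i < n].

Lemma nth_sign_tuple c n i : (i < n)%N ->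
  nth 0 (sign_tuple c n) i = if c i then 1 else -1.
Proof. by move=> lt_in; apply: (nth_mktuple _ 0 (Ordinal lt_in)). Qed.

Lemma nth_sign_tuple_opp (c : pred nat) n (i j : 'I_n) : c i != c j ->
  nth 0 (sign_tuple c n) i + nth 0 (sign_tuple c n) j = 0.
Proof. by rewrite !nth_sign_tuple //; do 2!case: (c _). Qed.

Lemma ones_expn n x : (x < 2 ^ n)%N -> ones x = (\sum_(b < n) odd (x %/ 2 ^ b))%N.
Proof.
have sum_widen m k : (x < 2 ^ m)%N -> (m <= k)%N ->
    (\sum_(b < k) odd (x %/ 2 ^ b) = \sum_(b < m) odd (x %/ 2 ^ b))%N.
  move=> lt_x le_mk; rewrite -(subnKC le_mk) big_split_ord /=.
  rewrite [X in (_ + X)%N]big1 ?addn0 // => b _.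
  by rewrite divn_small // (leq_trans lt_x) // leq_exp2l // leq_addr.
move=> lt_xn; have lt_xx : (x < 2 ^ x.+1)%N.
  by rewrite (leq_trans (ltn_expl x (ltnSn 1))) // leq_exp2l.
by rewrite /ones -(sum_widen _ _ lt_xx (leq_maxl x.+1 n)) (sum_widen n) // leq_maxr.
Qed.

Lemma inAp_divn_expn n x : (x < 2 ^ n.+1)%N ->
  inAp x = inAp (x %% 2 ^ n)%N (+) odd (x %/ 2 ^ n).
Proof.
move=> lt_x; rewrite /inAp (ones_expn lt_x) big_ord_recr /=.
rewrite (@ones_expn n (x %% 2 ^ n)) ?ltn_mod ?expn_gt0 //.
rewrite oddD oddb -addNb; congr (~~ odd _ (+) _); apply: eq_bigr => b _.
have high_digits : (x %/ 2 ^ n * 2 ^ n = x %/ 2 ^ n * 2 ^ (n - b) * 2 ^ b)%N.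
  by rewrite -mulnA -expnD subnK // ltnW.
rewrite {1}(divn_eq x (2 ^ n)) high_digits divnMDl ?expn_gt0 // oddD oddM oddX.
by rewrite subn_eq0 leqNgt ltn_ord andbF.
Qed.

Lemma pm1E n : pm1 n = sign_tuple inAp (2 ^ n).
Proof.
elim: n => [|n IHn]; apply: (@tuple_nth_eq _ 0) => i lt_i; rewrite nth_sign_tuple //.
  by case: i lt_i => // _; rewrite /inAp /ones big_ord1.
have lt_i2 : (i < 2 ^ n * 2)%N by rewrite -expnSr.
rewrite /pm1 /= nth_tcast nth_hz_mul // -/(pm1 n) IHn.
rewrite nth_sign_tuple ?ltn_mod ?expn_gt0 // (inAp_divn_expn lt_i).
have : (i %/ 2 ^ n < 2)%N by rewrite ltn_divLR ?expn_gt0 // mulnC.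
by case: (_ %/ _)%N => [|[|]] //=; case: inAp.
Qed.

Lemma pm1S n : gr_act (ptpid (2 ^ n.+1) (2 ^ n + 2 ^ n)) (pm1 n.+1) =
  cat_tuple (pm1 n) (map_tuple -%R (pm1 n)).
Proof.
have double : (2 ^ n.+1 = 2 ^ n + 2 ^ n)%N by rewrite expnS mul2n addnn.
rewrite -(tcast_act hz_is_GammaRing double); apply: (@tuple_nth_eq _ 0) => i lt_i.
rewrite nth_tcast !pm1E nth_sign_tuple ?double // (@inAp_divn_expn n) ?double //.
rewrite nth_cat size_tuple; case: ltnP => [lt_in|le_ni].
  by rewrite nth_sign_tuple // modn_small // divn_small // addbF.
have lt_in : (i - 2 ^ n < 2 ^ n)%N by rewrite ltn_subLR.
have -> : (i %% 2 ^ n = i - 2 ^ n)%N by rewrite -{1}(subnKC le_ni) modnDl modn_small.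
have -> : (i %/ 2 ^ n = 1)%N.
  by rewrite -(subnKC le_ni) divnDl // divnn expn_gt0 divn_small.
by rewrite (nth_map 0) ?size_tuple // nth_sign_tuple // addbT; case: inAp.
Qed.

Lemma hz_pm_pmap : gr_act (Defs.pmap 2 2) hz_pm = gr_one.
Proof.
apply: (@tuple_nth_eq _ 0) => -[|//] _.
by rewrite nth_hz_act // big_mkcond !big_ord_recl big_ord0 /= !pmv_pmap.
Qed.

End SignTuples.

Section Pm1Generates.
Local Open Scope ring_scope.

Lemma int_row_generated k (P : 'rV[int]_k -> Prop) :
    P 0 -> (forall v w, P v -> P w -> P (v - w)) -> (forall j, P (delta_mx 0 j)) ->
  forall v, P v.
Proof.
move=> P0 PB Pdelta v.
have PN w : P w -> P (- w) by rewrite -sub0r; apply: PB.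
have PD w z : P w -> P z -> P (w + z).
  by rewrite -[z in w + z]opprK => Pw /PN; apply: PB.
have PMn w n : P w -> P (w *+ n).
  by move=> Pw; elim: n => // n IHn; rewrite mulrS; apply: PD.
rewrite [v]row_sum_delta; apply: big_ind => // j _; rewrite -[v 0 j]intz scaler_int.
by case: (v 0 j) => n; [apply: PMn | rewrite NegzE mulrNz; apply/PN/PMn].
Qed.

Lemma pm1_act_sub k n m (f : ptmap (2 ^ n) k) (g : ptmap (2 ^ m) k) :
  exists N (h : ptmap (2 ^ N) k),
    hz_row (gr_act h (pm1 N)) = hz_row (gr_act f (pm1 n)) - hz_row (gr_act g (pm1 m)).
Proof.
pose N := maxn n m; pose double := ptpid (2 ^ N.+1) (2 ^ N + 2 ^ N).
pose restrict l (h : ptmap (2 ^ l) k) := ptcomp h (ptpid (2 ^ N) (2 ^ l)).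
exists N.+1, (ptcomp (ptcopair (restrict _ f) (restrict _ g)) double).
rewrite hz_act_comp pm1S hz_row_act_copair hz_row_act_opp !hz_act_comp.
by rewrite !(pw_pid hz_is_GammaRing hz_pm_pmap) ?leq_maxl ?leq_maxr.
Qed.

Lemma pm1_act_surj k (a : car HZ k) :
  exists n (f : ptmap (2 ^ n) k), gr_act f (pm1 n) = a.
Proof.
suff [n [f fa]] : exists n (f : ptmap (2 ^ n) k), hz_row (gr_act f (pm1 n)) = hz_row a.
  by exists n, f; apply: hz_row_inj.
move: (hz_row a); apply: int_row_generated => [|v w [n [f <-]] [m [g <-]]|j].
- have f := ptpid (2 ^ 0) k; have [n [g gf]] := pm1_act_sub f f.
  by exists n, g; rewrite gf subrr.
- exact: pm1_act_sub.
exists 0, (mkpt 1 k (fun=> j.+1)); apply/rowP => l.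
rewrite !mxE eqxx nth_hz_act // big_mkcond big_ord1 pmv_mkpt //= eqSS eq_sym.
by rewrite val_eqE; case: eqP.
Qed.

Lemma pm1_act_surj_tagged k (a : car HZ k) :
  exists p : {n & ptmap (2 ^ n) k}, gr_act (tagged p) (pm1 (tag p)) == a.
Proof.
by have [n [f <-]] := pm1_act_surj a; exists (Tagged (fun n => ptmap (2 ^ n) k) f).
Qed.

End Pm1Generates.

Section SignedFibers.
Local Open Scope ring_scope.
Variables (n k : nat) (c : pred nat).
Implicit Type f g : ptmap n k.

Definition reduced f :=
  [forall i : 'I_n, forall j : 'I_n,
    (pmv f i.+1 == pmv f j.+1) && (pmv f i.+1 != 0%N) ==> (c i == c j)].

Definition signed_fiber f (s : bool) (l : nat) :=
  [pred i : 'I_n | (pmv f i.+1 == l) && (c i == s)].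

Lemma hz_act_sign_tuple_card f l : (l < k)%N ->
  nth 0 (gr_act f (sign_tuple c n)) l =
  #|signed_fiber f true l.+1|%:Z - #|signed_fiber f false l.+1|%:Z.
Proof.
move=> lt_lk; rewrite nth_hz_act // (bigID (fun i : 'I_n => c i)) /=; congr (_ + _).
  rewrite (eq_bigr (fun=> 1)) => [|i /andP[_ ci]]; last by rewrite nth_sign_tuple // ci.
  by rewrite sumr_const natz; congr (_%:Z); apply: eq_card => i; rewrite !inE eqb_id.
rewrite (eq_bigr (fun=> - 1)) => [|i /andP[_ /negPf ci]]; last first.
  by rewrite nth_sign_tuple // ci.
rewrite sumrN sumr_const natz; congr (- _%:Z).
by apply: eq_card => i; rewrite !inE eqbF_neg.
Qed.

Lemma reduced_signed_fiber0 f l : reduced f ->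
  (#|signed_fiber f true l.+1| == 0%N) || (#|signed_fiber f false l.+1| == 0%N).
Proof.
move=> /forallP f_red; rewrite -[_ || _]negbK negb_or -!lt0n.
apply/negP => /andP[/card_gt0P[i] + /card_gt0P[j]].
rewrite !inE => /andP[/eqP fi /eqP ci] /andP[/eqP fj /eqP cj].
by have /forallP/(_ j) := f_red i; rewrite fi fj eqxx ci cj.
Qed.

Lemma sum_card_signed_fiber f s :
  (#|signed_fiber f s 0| + \sum_(l < k) #|signed_fiber f s l.+1|)%N =
  #|[pred i : 'I_n | c i == s]|.
Proof.
rewrite -[RHS]sum1_card.
rewrite (partition_big (fun i : 'I_n => sval f (lift ord0 i)) predT) //= big_ord_recl.
have fiberE l : (\sum_(i : 'I_n | (i \in [pred i : 'I_n | c i == s]) &&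
    (sval f (lift ord0 i) == l)) 1)%N = #|signed_fiber f s l|.
  rewrite sum1_card; apply: eq_card => i.
  by rewrite !inE andbC pmv_lift val_eqE.
by rewrite fiberE; congr (_ + _)%N; apply: eq_bigr => l _; rewrite fiberE.
Qed.

Lemma reduced_card_signed_fiber f g : reduced f -> reduced g ->
    gr_act f (sign_tuple c n) = gr_act g (sign_tuple c n) ->
  forall s l, #|signed_fiber f s l| = #|signed_fiber g s l|.
Proof.
move=> f_red g_red fg.
have eq_pos s l : (l < k)%N -> #|signed_fiber f s l.+1| = #|signed_fiber g s l.+1|.
  move=> lt_lk; have := congr1 (fun a : car HZ k => nth 0 a l) fg.
  rewrite !hz_act_sign_tuple_card //.
  have := reduced_signed_fiber0 l f_red; have := reduced_signed_fiber0 l g_red.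
  by case: s; lia.
move=> s [|l].
  have := sum_card_signed_fiber f s; rewrite -(sum_card_signed_fiber g s).
  by under eq_bigr => l _ do rewrite eq_pos //; move/addIn.
have [/eq_pos //|le_kl] := ltnP l k.
have fiber0 h : #|signed_fiber h s l.+1| = 0%N; last by rewrite !fiber0.
apply: eq_card0 => i; rewrite inE; apply/negP => /andP[/eqP hi _].
by move: le_kl; rewrite leqNgt -hi pmv_le.
Qed.

Lemma eq_card_signed_fiber_ptperm f g :
    (forall s l, #|signed_fiber f s l| = #|signed_fiber g s l|) ->
  exists2 p : {perm 'I_n}, forall i, c (p i) = c i &
    f = ptcomp g (ptperm (lift_perm ord0 ord0 p)).
Proof.
move=> fg; pose label (h : ptmap n k) (i : 'I_n) := (pmv h i.+1, c i).
have [[l s]|p fgp] := @eq_card_fibers_perm _ _ (label f) (label g); first exact: fg.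
exists p => [i|]; first by case: (fgp i).
apply: ptmap_eq => -[|l] //= lt_ln; rewrite pmv_comp //.
have lift_l : inord l.+1 = lift ord0 (Ordinal lt_ln).
  by apply: val_inj; rewrite /= inordK.
rewrite [pmv (ptperm _) _]pmv_mkpt // lift_l lift_perm_lift ?ltn_ord //.
by have [] := fgp (Ordinal lt_ln).
Qed.

End SignedFibers.

Section SignedElement.
Variables (R : GRData) (R_ring : is_GammaRing R) (n : nat) (c : pred nat) (x : car R n).
Hypothesis x_perm : forall s : {perm 'I_n.+1}, s ord0 = ord0 ->
  (forall y, y != ord0 -> c (s y).-1 = c y.-1) -> gr_act (ptperm s) x = x.
Hypothesis x_cancel : forall i j, 0 < i < j -> j <= n -> c i.-1 != c j.-1 ->
  gr_act (smap n i j i) x =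
  gr_act (dmap n.-1 i) (gr_act (Defs.pmap n.-1 i) (gr_act (Defs.pmap n j) x)).

Lemma gr_act_erase k (f : ptmap n k) (i j : 'I_n) :
  c i != c j -> pmv f i.+1 = pmv f j.+1 -> gr_act f x = gr_act (erase f i.+1 j.+1) x.
Proof.
wlog lt_ij : i j / i < j => [gen_ij cij fij|cij fij].
  have [lt_ij|lt_ji|eq_ij] := ltngtP i j; first exact: gen_ij.
    by rewrite eraseC; apply: gen_ij; rewrite // eq_sym.
  by rewrite eq_ij eqxx in cij.
rewrite -[in LHS](@ptcomp_dmap_smap n k f i.+1 j.+1) // -ptcomp_dmap_pmap //.
by rewrite !gr_act_comp // x_cancel.
Qed.

Lemma exists_reduced k (f : ptmap n k) :
  exists2 g : ptmap n k, reduced c g &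
    gr_act f x = gr_act g x /\
    gr_act f (sign_tuple c n) = gr_act g (sign_tuple c n).
Proof.
have [m] := ubnP #|[pred i : 'I_n | pmv f i.+1 != 0]|.
elim: m f => // m IHm f; rewrite ltnS => le_fm.
have [f_red|] := boolP (reduced c f); first by exists f.
rewrite negb_forall => /existsP[i]; rewrite negb_forall => /existsP[j].
rewrite negb_imply -andbA => /and3P[/eqP fij fi cij].
have [|g g_red [eraseg signg]] := IHm (erase f i.+1 j.+1).
  apply: leq_trans le_fm; apply: proper_card; apply/properP; split.
    by apply/subsetP => t; rewrite !inE pmv_erase ?ltn_ord //; case: ifP.
  by exists i; rewrite !inE // pmv_erase ?ltn_ord // eqxx.
have i_neq_j : i != j by apply: contraNneq cij => ->.
exists g => //; rewrite -eraseg -signg hz_act_erase ?nth_sign_tuple_opp //; split=> //.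
exact: gr_act_erase.
Qed.

Lemma gr_act_eq_sign_tuple k (f g : ptmap n k) :
  gr_act f (sign_tuple c n) = gr_act g (sign_tuple c n) -> gr_act f x = gr_act g x.
Proof.
have [f' f'_red [-> ->]] := exists_reduced f.
have [g' g'_red [-> ->]] := exists_reduced g.
move=> /(reduced_card_signed_fiber f'_red g'_red)/eq_card_signed_fiber_ptperm[p cp ->].
rewrite gr_act_comp // x_perm // => [|y]; first by rewrite lift_perm_id.
by case: (unliftP ord0 y) => [i ->|->] // _; rewrite lift_perm_lift /= cp.
Qed.

End SignedElement.

Section DifferenceLaw.
Variables (R : GRData) (R_ring : is_GammaRing R) (r : car R 2) (r_fdl : fdl r).

Lemma fdl_act_pw_eq k n m (f : ptmap (2 ^ n) k) (g : ptmap (2 ^ m) k) :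
  gr_act f (pm1 n) = gr_act g (pm1 m) -> gr_act f (pw r n) = gr_act g (pw r m).
Proof.
have [[r_pmap _] _ r_perm r_cancel] := r_fdl.
pose N := (maxn n m).+1.
have [le_nN le_mN] : n <= N /\ m <= N by rewrite !leqW ?leq_maxl ?leq_maxr.
rewrite /pm1 -!(pw_pid hz_is_GammaRing hz_pm_pmap le_nN).
rewrite -!(pw_pid hz_is_GammaRing hz_pm_pmap le_mN).
rewrite -(pw_pid R_ring r_pmap le_nN) -(pw_pid R_ring r_pmap le_mN).
rewrite -!hz_act_comp -!gr_act_comp // -/(pm1 N) pm1E.
apply: gr_act_eq_sign_tuple => // [s s0 s_sign|i j /andP[i_gt0 lt_ij] le_jN cij].
  exact: r_perm.
by apply: r_cancel => //; lia.
Qed.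

Definition fdl_hom k (a : car HZ k) : car R k :=
  let p := xchoose (pm1_act_surj_tagged a) in gr_act (tagged p) (pw r (tag p)).

Lemma fdl_homE k n (f : ptmap (2 ^ n) k) (a : car HZ k) :
  gr_act f (pm1 n) = a -> fdl_hom a = gr_act f (pw r n).
Proof.
move=> fa; apply: fdl_act_pw_eq; rewrite fa.
by apply/eqP/(xchooseP (pm1_act_surj_tagged a)).
Qed.

Lemma fdl_hom_pm1 n : fdl_hom (pm1 n) = pw r n.
Proof. by rewrite (fdl_homE (f := ptid _)) ?hz_act_id // gr_act_id. Qed.

Lemma fdl_hom_act n m (g : ptmap n m) (a : car HZ n) :
  fdl_hom (gr_act g a) = gr_act g (fdl_hom a).
Proof.
have [N [f fa]] := pm1_act_surj a.
by rewrite (fdl_homE fa) -gr_act_comp //; apply: fdl_homE; rewrite hz_act_comp fa.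
Qed.

Lemma fdl_hom_mul n m (a : car HZ n) (b : car HZ m) :
  fdl_hom (gr_mul a b) = gr_mul (fdl_hom a) (fdl_hom b).
Proof.
have [N [f fa]] := pm1_act_surj a; have [M [g gb]] := pm1_act_surj b.
rewrite (fdl_homE fa) (fdl_homE gb) gr_mul_act // pwD // -gr_act_comp //.
apply: fdl_homE; rewrite hz_act_comp -(pwD hz_is_GammaRing) -hz_mul_act.
by rewrite -fa -gb.
Qed.

Lemma fdl_hom_is_mult : is_mult fdl_hom.
Proof.
split; [exact: fdl_hom_act | move=> n | exact: (fdl_hom_pm1 0) | exact: fdl_hom_mul].
rewrite -(hz_act_pt (ptpid 0 n)) fdl_hom_act.
by rewrite (gr_pt_unique R_ring (fdl_hom _)) gr_act_pt.
Qed.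

End DifferenceLaw.

Theorem theorem3p4 (R : GRData) (HR : is_GammaRing R) (r : car R 2) (Hr : fdl r) :
  exists phi : forall n, car HZ n -> car R n,
    [/\ is_mult phi,
        (forall n, phi (2 ^ n)%N (pm1 n) = pw r n),
        (forall k n (f : ptmap (2 ^ n) k) (a : car HZ k),
            gr_act f (pm1 n) = a -> phi k a = gr_act f (pw r n)) &
        (forall psi : forall n, car HZ n -> car R n,
            is_mult psi -> (forall n, psi (2 ^ n)%N (pm1 n) = pw r n) ->
            forall n (x : car HZ n), psi n x = phi n x)].
Proof.
exists (fdl_hom r); split.
- exact: fdl_hom_is_mult.
- exact: fdl_hom_pm1.
- exact: fdl_homE.
move=> psi [psi_act _ _ _] psi_pm1 n x; have [m [f <-]] := pm1_act_surj x.
by rewrite psi_act psi_pm1 (fdl_homE HR Hr (f := f)).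
Qed.
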